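(* Let $J=a_0(x)I+a_1(x)D+\frac{a_2(x)}{2}D^2+\frac{a_3(x)}{3!}D^3$ be a differential operator on $\mathcal P$, where $a_0(x)=a_0^{[0]}$, $a_1(x)=a_0^{[1]}+a_1^{[1]}x$, $a_2(x)=a_0^{[2]}+a_1^{[2]}x+a_2^{[2]}x^2$, $a_3(x)=a_0^{[3]}+a_1^{[3]}x+a_2^{[3]}x^2+a_3^{[3]}x^3$ have complex coefficients, and assume that $J$ is an isomorphism of $\mathcal P$, i.e. $\lambda_n^{[0]}:=\sum_{\mu=0}^{n}\binom{n}{\mu}a_\mu^{[\mu]}\neq 0$ for all $n\ge 0$ (with $a_\mu^{[\mu]}=0$ for $\mu\ge 4$). Let $\{P_n(x)\}_{n\ge 0}$ be a $2$-orthogonal monic polynomial sequence, with recurrence coefficients $\{\beta_n\}_{n\ge0}$, $\{\alpha_n\}_{n\ge1}$, $\{\gamma_n\}_{n\ge1}$ and dual sequence $\{u_n\}_{n\ge0}$, such that $J(P_n(x))=\lambda_n^{[0]}P_n(x)$ for all $n\ge 0$. Suppose that $$a_2(x)=0,\qquad a_1(x)=-\frac{1}{3\gamma_1}(x-\beta_0),\qquad a_3^{[3]}\neq\frac{1}{\gamma_1(m+1)}\ \text{ for all integers } m\ge 0.$$ Then $\{P_n(x)\}_{n\ge0}$ is classical in Hahn's sense, and the regular vector functional $U=(u_0,u_1)^T$ satisfies $$D\left(\Phi(x)U\right)+\Psi(x)U=0,$$ where $$\Psi(x)=\begin{bmatrix}0&1\\ 2E_1(x)&0\end{bmatrix},\quad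 E_1(x)=\frac{1}{\gamma_1}(x-\beta_0),\qquad \Phi(x)=\begin{bmatrix}\phi_{1,1}(x)&\phi_{1,2}(x)\\ \phi_{2,1}(x)&\phi_{2,2}(x)\end{bmatrix},$$ with $$\phi_{1,1}(x)=\alpha_2\Big(\frac{1}{3\gamma_1}-a_3^{[3]}\Big)x+a_3^{[3]}(\alpha_2\beta_0-\gamma_1)-\frac{\alpha_2\beta_0}{3\gamma_1}+1,$$ $$\phi_{1,2}(x)=a_3^{[3]}\gamma_1x+\frac13\Big(-2\beta_0+\beta_1(2-3a_3^{[3]}\gamma_1)\Big),$$ $$\phi_{2,1}(x)=4a_3^{[3]}x^2+\frac{1}{3\gamma_1\gamma_2}\Big(\alpha_2\alpha_3(-1+9a_3^{[3]}\gamma_1)-2\big(\beta_2(-1+6a_3^{[3]}\gamma_1)+\beta_0(1+6a_3^{[3]}\gamma_1)\big)\gamma_2\Big)x$$ $$\qquad+\frac{1}{3\gamma_1\gamma_2}\Big(\alpha_3(\alpha_2\beta_0-\gamma_1)(1-9a_3^{[3]}\gamma_1)+2\beta_0\big(\beta_0+\beta_2(-1+6a_3^{[3]}\gamma_1)\big)\gamma_2\Big),$$ $$\phi_{2,2}(x)=\frac{1}{3\gamma_2}\alpha_3(1-9a_3^{[3]}\gamma_1)x+\frac{1}{3\gamma_2}\Big(\alpha_3\beta_1(-1+9a_3^{[3]}\gamma_1)+3(1-4a_3^{[3]}\gamma_1)\gamma_2\Big).$$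
   Context: $\mathcal P$ is the vector space of polynomials in one variable with complex coefficients, $\mathcal P'$ its dual space, $\langle u,p\rangle$ the action of $u\in\mathcal P'$ on $p\in\mathcal P$. $D$ is the usual derivative on $\mathcal P$; on $\mathcal P'$, $\langle Du,p\rangle=-\langle u,p'\rangle$, and for a polynomial $\varpi$ the form $\varpi u$ is defined by $\langle\varpi u,p\rangle=\langle u,\varpi p\rangle$. On vectors of forms, $D$ acts componentwise, and a polynomial matrix times a vector of forms is the usual matrix-vector product using left-multiplication. A monic polynomial sequence (MPS) is a sequence $\{P_n\}_{n\ge0}$ of monic polynomials with $\deg P_n=n$. Its dual sequence $\{u_n\}_{n\ge0}\subset\mathcal P'$ is the unique sequence with $\langle u_n,P_m\rangle=\delta_{n,m}$. The MPS is $2$-orthogonal (with respect to $U=(u_0,u_1)$, in which case $U$ is called regular) if for $\nu=0,1$ and all $m\ge0$: $\langle u_\nu,P_mP_n\rangle=0$ for $n\ge 2m+\nu+1$ and $\langle u_\nu,P_mP_{2m+\nu}\rangle\ne0$. Equivalently, there are complex constants $\{\beta_n\}_{n\ge0}$, $\{\alpha_n\}_{n\ge1}$, $\{\gamma_n\}_{n\ge1}$ with $\gamma_{n+1}\neq0$ for $n\ge0$ such that $P_0=1$, $P_1=x-\beta_0$, $P_2=(x-\beta_1)P_1-\alpha_1$, and $P_{n+3}=(x-\beta_{n+2})P_{n+2}-\alpha_{n+2}P_{n+1}-\gamma_{n+1}P_n$ for $n\ge0$; these are the recurrence coefficients. A $2$-orthogonal MPS $\{P_n\}_{n\ge0}$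 is classical in Hahn's sense if the MPS $\{(n+1)^{-1}DP_{n+1}(x)\}_{n\ge0}$ is also $2$-orthogonal. *)

(* Defs.v *)
From HB Require Import structures.
From mathcomp Require Import all_boot all_order all_algebra.
From mathcomp Require Import reals complex.

Set Implicit Arguments.
Unset Strict Implicit.
Unset Printing Implicit Defensive.

Import Order.TTheory GRing.Theory Num.Theory.
Local Open Scope ring_scope.

Section Forms.
Variable K : numFieldType.
Implicit Types (u : {scalar {poly K}}) (w p : {poly K}).

Definition form_deriv u p : K := - u p^`().

Fact form_deriv_is_scalar u : scalar (form_deriv u).
Proof.
by move=> c p q; rewrite /form_deriv derivD derivZ linearP opprD mulrN.
Qed.

HB.instance Definition _ u :=
  GRing.isLinear.Build K {poly K} K *%R (form_deriv u)
    (form_deriv_is_scalar u).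

Definition form_mul w u p : K := u (w * p).

Fact form_mul_is_scalar w u : scalar (form_mul w u).
Proof. by move=> c p q; rewrite /form_mul mulrDr -scalerAr linearP. Qed.

HB.instance Definition _ w u :=
  GRing.isLinear.Build K {poly K} K *%R (form_mul w u)
    (form_mul_is_scalar w u).

Definition form_mulmx n (M : 'M[{poly K}]_n) (U : 'I_n -> {scalar {poly K}})
  (i : 'I_n) p : K := \sum_(j < n) form_mul (M i j) (U j) p.

Fact form_mulmx_is_scalar n (M : 'M[{poly K}]_n) U i :
  scalar (@form_mulmx n M U i).
Proof.
move=> c p q; rewrite /form_mulmx mulr_sumr -big_split /=.
by apply: eq_bigr => j _; rewrite linearP.
Qed.

HB.instance Definition _ n (M : 'M[{poly K}]_n) U i :=
  GRing.isLinear.Build K {poly K} K *%R (form_mulmx M U i)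
    (form_mulmx_is_scalar M U i).

End Forms.

Section TwoOrthogonality.
Variable K : numFieldType.
Implicit Types (P : nat -> {poly K}) (u : nat -> {scalar {poly K}}).

Definition monic_poly_seq P : Prop :=
  forall n, (P n \is monic) /\ size (P n) = n.+1.

Definition dual_seq P u : Prop := forall n m, u n (P m) = (n == m)%:R.

Definition form_pair u : 'I_2 -> {scalar {poly K}} := fun nu => u nu.

Definition two_orthogonal_wrt P (U : 'I_2 -> {scalar {poly K}}) : Prop :=
  forall (nu : 'I_2) (m : nat),
    (forall n, (2 * m + nu + 1 <= n)%N -> U nu (P m * P n) = 0)
    /\ U nu (P m * P (2 * m + nu)%N) != 0.

(* The dual sequence of an MPS exists and is unique, so quantifying it
   existentially or universally is the same. *)
Definition two_orthogonal_MPS P : Prop :=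
  monic_poly_seq P /\
  exists u, dual_seq P u /\ two_orthogonal_wrt P (form_pair u).

(* The values [alpha 0] and [gamma 0] are unused. *)
Definition recurrence_coefficients P (beta alpha gamma : nat -> K) : Prop :=
  [/\ P 0%N = 1,
      P 1%N = 'X - (beta 0%N)%:P,
      P 2%N = ('X - (beta 1%N)%:P) * P 1%N - (alpha 1%N)%:P,
      (forall n, P n.+3 = ('X - (beta n.+2)%:P) * P n.+2
                          - alpha n.+2 *: P n.+1 - gamma n.+1 *: P n)
    & forall n, gamma n.+1 != 0].

Definition deriv_MPS P : nat -> {poly K} :=
  fun n => n.+1%:R^-1 *: (P n.+1)^`().

Definition Hahn_classical P : Prop :=
  two_orthogonal_MPS P /\ two_orthogonal_MPS (deriv_MPS P).

End TwoOrthogonality.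

Section Operator.
Variable K : numFieldType.

Definition opJ (a0 a1 a2 a3 p : {poly K}) : {poly K} :=
  a0 * p + a1 * p^`() + (2^-1 *: a2) * p^`(2) + ((3`!)%:R^-1 *: a3) * p^`(3).

(* [[:: a0; a1; a2; a3]`_mu] is [0] when [4 <= mu]. *)
Definition eigenvalJ (a0 a1 a2 a3 : {poly K}) (n : nat) : K :=
  \sum_(mu < n.+1) 'C(n, mu)%:R * ([:: a0; a1; a2; a3]`_mu)`_mu.

End Operator.

Section FunctionalEquation.
Variable K : numFieldType.

Definition mx2 (a b c d : {poly K}) : 'M[{poly K}]_2 :=
  \matrix_(i, j) (nth [::] [:: [:: a; b]; [:: c; d]] i)`_j.

Variables (beta alpha gamma : nat -> K) (t : K).
Let b0 := beta 0%N.
Let b1 := beta 1%N.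
Let b2 := beta 2%N.
Let al2 := alpha 2%N.
Let al3 := alpha 3%N.
Let g1 := gamma 1%N.
Let g2 := gamma 2%N.

Definition E1 : {poly K} := g1^-1 *: ('X - b0%:P).

Definition phi11 : {poly K} :=
  (al2 * (1 / (3 * g1) - t)) *: 'X
  + (t * (al2 * b0 - g1) - al2 * b0 / (3 * g1) + 1)%:P.

Definition phi12 : {poly K} :=
  (t * g1) *: 'X + (1 / 3 * (- 2 * b0 + b1 * (2 - 3 * t * g1)))%:P.

Definition phi21 : {poly K} :=
  (4 * t) *: 'X^2
  + (1 / (3 * g1 * g2)
     * (al2 * al3 * (- 1 + 9 * t * g1)
        - 2 * (b2 * (- 1 + 6 * t * g1) + b0 * (1 + 6 * t * g1)) * g2)) *: 'X
  + (1 / (3 * g1 * g2)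
     * (al3 * (al2 * b0 - g1) * (1 - 9 * t * g1)
        + 2 * b0 * (b0 + b2 * (- 1 + 6 * t * g1)) * g2))%:P.

Definition phi22 : {poly K} :=
  (1 / (3 * g2) * al3 * (1 - 9 * t * g1)) *: 'X
  + (1 / (3 * g2)
     * (al3 * b1 * (- 1 + 9 * t * g1) + 3 * (1 - 4 * t * g1) * g2))%:P.

Definition Phi : 'M[{poly K}]_2 := mx2 phi11 phi12 phi21 phi22.

Definition Psi : 'M[{poly K}]_2 := mx2 0 1 (2 *: E1) 0.

End FunctionalEquation.

(* Main.v *)
Require Import Defs.
From HB Require Import structures.
From mathcomp Require Import all_boot all_order all_algebra.
From mathcomp Require Import reals complex.
From mathcomp Require Import ring zify.

Set Implicit Arguments.
Unset Strict Implicit.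
Unset Printing Implicit Defensive.

Import Order.TTheory GRing.Theory Num.Theory.
Local Open Scope ring_scope.

(** The theorem is true because its hypotheses leave very few sequences P.

    Put Y = X - beta_0 and c = - (gamma_1 / 2) a_3. Up to an additive constant
    and a factor, the operator J is N = Y D + c D^3, and P_n is an eigenvector
    of N for the eigenvalue n + tau C(n, 3), where tau = - 3 gamma_1 a_3^[3].
    In the basis P the operator N is thus diagonal, while multiplication by Y
    is a band matrix with one diagonal above and two below the main one. Every
    commutator of N with Y lowers the order in D, and the triple one is
    multiplication by 6 c (third_order_triple_comm), a cubic in Y with leading
    coefficient tau. Six places below the diagonal, 6 c has the entry tau times
    a product of three gammas, whereas the triple commutator has a third
    difference of step -2 of the eigenvalues, - 8 tau, times the same product.
    Hence tau = 0 (cubic_eigenvalue0). With b = beta_2 - beta_0 and a = alpha_2,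
    entries near the corner then give a^2 = 3 b gamma_1
    (low_recurrence_coefficients), so the quadratic
    6 c = - (b Y^2 + 2 a Y + 3 gamma_1) has a double root, or is constant.

    This double root provides a lowering operator V, with [N, V] = - V, such
    that ell P_n' is a combination of P_n and P_(n-1) for ell = b Y + a
    (dual_ell_deriv). Differentiating [N, Y] = Y + 3 c D^2 then expresses
    3 (n + 1) P_n through derivatives only (deriv_dual_P), and P_n turns out to
    be a combination of Q_n, Q_(n-1), Q_(n-2), where Q_n = P_(n+1)' / (n + 1).
    All of this is read on dual sequences: the dual sequence v of Q satisfies
    v_i(q') = (i + 1) u_(i+1)(q), and the claim is v_i(P_n) = 0 for n > i + 2
    (deriv_dual_P_band). As X P' = (X P)' - P, multiplication by X has the same
    band shape for Q as for P, with nonzero multiples of the same gammas on its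
    lowest diagonal; so Q is 2-orthogonal.

    The same facts give v_0 = u_0 + (alpha_2 / 3) u_2 and
    v_1 = u_1 + (2 b / 3) u_2 + (alpha_3 / 3) u_3. Rewriting u_2 and u_3 through
    Y u_0 = gamma_1 u_2 and Y u_1 = u_0 + alpha_2 u_2 + gamma_2 u_3 turns
    (v_0, v_1) into Phi U, and D v_0 = - u_1, D v_1 = - 2 u_2 = - 2 E_1 u_0 is
    the functional equation. *)

(** * Monic polynomial sequences and their dual sequences *)

Section Bases.
Variable K : numFieldType.
Implicit Types (P : nat -> {poly K}) (u : nat -> {scalar {poly K}}).
Implicit Types (p q : {poly K}).

Lemma size_sub_lead P : monic_poly_seq P -> forall n (p : {poly K}),
  size p = n.+1 -> (size (p - lead_coef p *: P n)%R <= n)%N.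
Proof.
move=> mpsP n p szp; have [/monicP leadPn szPn] := mpsP n.
apply/leq_sizeP => j; rewrite leq_eqVlt => /predU1P[<-|ltnj].
  rewrite coefB coefZ; move: leadPn; rewrite /lead_coef szPn szp /= => ->.
  by rewrite mulr1 subrr.
by rewrite coefB coefZ !nth_default ?szp ?szPn // mulr0 subrr.
Qed.

(** An induction principle replacing expansions in the basis P: an identity that
    is linear in p need only be checked on the P n. *)
Lemma mps_ind P : monic_poly_seq P -> forall S : {poly K} -> Prop,
  S 0 -> (forall a p q, S p -> S q -> S (a *: p + q)) ->
  (forall n, S (P n)) -> forall p, S p.
Proof.
move=> mpsP S S0 Slin SP p; have [m] := ubnP (size p).
elim: m p => // m IHm p; rewrite ltnS => szp.
have [->|p_neq0] := eqVneq p 0; first exact: S0.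
have szp1 : size p = (size p).-1.+1 by rewrite prednK // lt0n size_poly_eq0.
rewrite -(subrK (lead_coef p *: P (size p).-1) p) addrC; apply: Slin => //.
apply: IHm; rewrite szp1 in szp.
exact: leq_ltn_trans (size_sub_lead mpsP szp1) szp.
Qed.

Lemma dual_seq_small P u : monic_poly_seq P -> dual_seq P u ->
  forall n p, (size p <= n)%N -> u n p = 0.
Proof.
move=> mpsP dualPu n p; have [m] := ubnP (size p).
elim: m p => // m IHm p; rewrite ltnS => szp szpn.
have [->|p_neq0] := eqVneq p 0; first exact: linear0.
have szp1 : size p = (size p).-1.+1 by rewrite prednK // lt0n size_poly_eq0.
rewrite szp1 in szp szpn.
rewrite -(subrK (lead_coef p *: P (size p).-1) p) linearD scalarZ dualPu.
rewrite gtn_eqF // mulr0 addr0; have szq := size_sub_lead mpsP szp1.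
by apply: IHm; [exact: leq_ltn_trans szq szp|exact: leq_trans szq (ltnW szpn)].
Qed.

Lemma mps_expansion P u : monic_poly_seq P -> dual_seq P u ->
  forall n p, (size p <= n)%N -> p = \sum_(i < n) u i p *: P i.
Proof.
move=> mpsP dualPu n p; elim: n p => [|n IHn] p szp.
  by rewrite big_ord0; apply/eqP; rewrite -size_poly_eq0 -leqn0.
have step q : (size q <= n)%N ->
    forall a, a *: P n + q = \sum_(i < n.+1) u i (a *: P n + q) *: P i.
  move=> szq a; rewrite big_ord_recr /= linearD scalarZ dualPu eqxx mulr1.
  rewrite (dual_seq_small mpsP dualPu szq) addr0 addrC {1}(IHn q szq).
  congr (_ + _); apply: eq_bigr => i _.
  by rewrite linearD scalarZ dualPu ltn_eqF // mulr0 add0r.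
move: szp; rewrite leq_eqVlt => /predU1P[szp|szp].
  have := step _ (size_sub_lead mpsP szp) (lead_coef p).
  by rewrite addrC subrK.
by have := step p szp 0; rewrite scale0r add0r.
Qed.

(** A converse of the recurrence relation: a lower bandwidth of exactly two for
    multiplication by X is all that 2-orthogonality requires. Indeed X ^ m then
    has lower bandwidth exactly 2 m, and P m is X ^ m plus lower powers. *)
Lemma two_orthogonal_of_band P u : monic_poly_seq P -> dual_seq P u ->
  (forall i n, (i + 2 < n)%N -> u i ('X * P n) = 0) ->
  (forall i, u i ('X * P i.+2) != 0) ->
  two_orthogonal_wrt P (form_pair u).
Proof.
move=> mpsP dualPu band corner.
have bandX n m i : ((2 * m + i < n)%N -> u i ('X^m * P n) = 0) /\
    (n = (2 * m + i)%N -> u i ('X^m * P n) != 0).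
  have XPn k : 'X * P k = \sum_(j < k.+2) u j ('X * P k) *: P j.
    apply: mps_expansion => //; have [monPk szPk] := mpsP k.
    by rewrite size_proper_mul ?lead_coefX ?mul1r ?size_polyX ?szPk //
       (monicP monPk) oner_eq0.
  elim: m n i => [|m IHm] n i.
    rewrite muln0 add0n expr0 mul1r dualPu; split=> [/ltn_eqF->//|->].
    by rewrite eqxx oner_eq0.
  (* Among the terms P_j of X P_n, n - 2 <= j <= n + 1, only j = n - 2 can reach
     the lowest diagonal of X ^ m.+1. *)
  rewrite exprSr -mulrA XPn mulr_sumr linear_sum /=.
  have term (j : 'I_n.+2) :
      u i ('X^m * (u j ('X * P n) *: P j)) =
      u j ('X * P n) * u i ('X^m * P j).
    by rewrite -scalerAr scalarZ.
  have low (j : 'I_n.+2) : (2 * m.+1 + i <= n)%N -> (j != n - 2 :> nat)%N ->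
      u i ('X^m * (u j ('X * P n) *: P j)) = 0.
    move=> len neqj; rewrite term; have [ltj|lej] := ltnP (j + 2) n.
      by rewrite band ?mul0r.
    rewrite (IHm j i).1 ?mulr0 //; move: neqj lej len; rewrite mulnS.
    by case: n j {XPn term} => [|[|n]] j; rewrite ?subSS ?subn0 //; lia.
  split=> [ltn|eqn].
    rewrite big1 // => j _.
    have [eqj|neqj] := eqVneq (j : nat) (n - 2)%N; last by rewrite low // ltnW.
    by rewrite term (IHm j i).1 ?mulr0 // eqj; lia.
  have ltn2 : (2 * m + i < n.+2)%N by lia.
  rewrite (bigD1 (Ordinal ltn2)) //= big1 => [|j neqj].
    rewrite addr0 /= -scalerAr scalarZ /= mulf_neq0 ?(IHm _ _).2 //.
    have -> : n = (2 * m + i).+2 by lia.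
    exact: corner.
  apply: low; rewrite ?eqn //; apply: contra neqj => /eqP eqj.
  by apply/eqP/val_inj => /=; rewrite eqj; lia.
move=> nu m; rewrite /form_pair.
have [monPm szPm] := mpsP m.
have PmE n : u nu (P m * P n) =
    \sum_(j < m.+1) (P m)`_j * u nu ('X^j * P n).
  rewrite -{1}[P m]coefK szPm poly_def mulr_suml linear_sum.
  by apply: eq_bigr => j _; rewrite -scalerAl scalarZ.
split=> [n len|]; rewrite PmE.
  apply: big1 => j _; rewrite (bandX _ _ _).1 ?mulr0 //.
  by have := ltn_ord j; lia.
rewrite big_ord_recr /= big1 ?add0r => [|j _].
  have -> : (P m)`_m = 1 by move/monicP: monPm; rewrite /lead_coef szPm.
  by rewrite mul1r (bandX _ _ _).2.
by rewrite (bandX _ _ _).1 ?mulr0 //; have := ltn_ord j; lia.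
Qed.

(** The antiderivative with zero constant term: at i = 0 the quotient is a
    division by 0, whose value is 0. *)
Definition primitive (p : {poly K}) : {poly K} :=
  \poly_(i < (size p).+1) (p`_i.-1 / i%:R).

Lemma coef_primitive p i : (primitive p)`_i = p`_i.-1 / i%:R.
Proof.
rewrite coef_poly; case: ltnP => //; case: i => [|i] //= lepi.
by rewrite nth_default ?mul0r.
Qed.

Fact primitive_is_linear : linear primitive.
Proof.
move=> a p q; apply/polyP => i.
by rewrite !(coef_primitive, coefD, coefZ) mulrDl mulrA.
Qed.

HB.instance Definition _ :=
  GRing.isLinear.Build K {poly K} {poly K} *:%R primitive primitive_is_linear.

Lemma primitive_deriv p : primitive p^`() = p - (p`_0)%:P.
Proof.
apply/polyP => -[|i]; rewrite coef_primitive coefB coefC /=.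
  by rewrite invr0 mulr0 subrr.
by rewrite coef_deriv -(mulr_natr p`_i.+1) mulfK ?pnatr_eq0 // subr0.
Qed.

(** This is dual to [deriv_MPS P] because [primitive] inverts the derivative up
    to a constant, and u n.+1 vanishes on constants. *)
Definition deriv_dual u (n : nat) (p : {poly K}) : K :=
  n.+1%:R * u n.+1 (primitive p).

Fact deriv_dual_is_scalar u n : scalar (deriv_dual u n).
Proof.
by move=> a p q; rewrite /deriv_dual linearP linearD scalarZ mulrDr mulrCA.
Qed.

HB.instance Definition _ u n :=
  GRing.isLinear.Build K {poly K} K *%R (deriv_dual u n)
    (deriv_dual_is_scalar u n).

Lemma deriv_dual_deriv P u : monic_poly_seq P -> dual_seq P u ->
  forall n p, deriv_dual u n p^`() = n.+1%:R * u n.+1 p.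
Proof.
move=> mpsP dualPu n p; rewrite /deriv_dual primitive_deriv linearB.
rewrite (dual_seq_small mpsP dualPu (leq_trans (size_polyC_leq1 _) _)) //.
by rewrite subr0.
Qed.

Lemma deriv_MPS_monic P : monic_poly_seq P -> monic_poly_seq (deriv_MPS P).
Proof.
move=> mpsP n; have [/monicP leadP szP] := mpsP n.+1.
have coefQ j : (deriv_MPS P n)`_j = n.+1%:R^-1 * ((P n.+1)`_j.+1 *+ j.+1).
  by rewrite coefZ coef_deriv.
have Qn : (deriv_MPS P n)`_n = 1.
  move: leadP; rewrite coefQ /lead_coef szP /= => ->.
  by rewrite mulVf // pnatr_eq0.
have szQ : size (deriv_MPS P n) = n.+1.
  apply/eqP; rewrite eqn_leq; apply/andP; split.
    apply/leq_sizeP => j ltnj.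
    by rewrite coefQ nth_default ?szP // mul0rn mulr0.
  rewrite ltnNge; apply/negP => /leq_sizeP/(_ n (leqnn n))/eqP.
  by rewrite Qn oner_eq0.
by split=> //; apply/monicP; rewrite /lead_coef szQ.
Qed.

Lemma deriv_dual_dual P u : monic_poly_seq P -> dual_seq P u ->
  dual_seq (deriv_MPS P) (deriv_dual u).
Proof.
move=> mpsP dualPu n m.
rewrite scalarZ /= (deriv_dual_deriv mpsP dualPu) dualPu eqSS.
by case: eqP => [->|_]; rewrite ?mulr0 // mulr1 mulVf // pnatr_eq0.
Qed.

End Bases.

(** * The operator Y D + c D^3 *)

(** Turns an equation x = y into any other one that is equivalent to it up to a
    positive integer factor, the factor being checked by [ring] or [field]. *)
Lemma eq_of_scaled_sub (K : numFieldType) (k : nat) (x y z t : K) :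
  x = y -> x - y = k.+1%:R * (z - t) -> z = t.
Proof.
move=> -> /esym/eqP; rewrite subrr mulf_eq0 pnatr_eq0 /= subr_eq0.
by move/eqP.
Qed.

Section Operators.
Variables (K : numFieldType) (Y : {poly K}).
Hypothesis derivY : Y^`() = 1.
Implicit Types (c p q : {poly K}).

Definition third_order c p : {poly K} := Y * p^`() + c * p^`(3).

Fact third_order_is_linear c : linear (third_order c).
Proof.
move=> a p q; rewrite /third_order derivD derivZ derivnD derivnZ.
by rewrite -!mul_polyC; ring.
Qed.

HB.instance Definition _ c :=
  GRing.isLinear.Build K {poly K} {poly K} *:%R (third_order c)
    (third_order_is_linear c).

Let deriv_natr n : (n%:R : {poly K})^`() = 0.
Proof. by rewrite -polyC_natr derivC. Qed.

Let derE :=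
  (derivnS, derivn0, derivD, derivN, derivM, derivC, deriv_natr, derivY).

Lemma third_order_comm c p :
  third_order c (Y * p) - Y * third_order c p = Y * p + 3 * c * p^`(2).
Proof. by rewrite /third_order !derE; ring. Qed.

Lemma third_order_triple_comm c p :
  third_order c (Y * (Y * (Y * p))) - 3 * (Y * third_order c (Y * (Y * p)))
  + 3 * (Y * (Y * third_order c (Y * p))) - Y * (Y * (Y * third_order c p))
  = 6 * c * p.
Proof. by rewrite /third_order !derE; ring. Qed.

(** The derivative of the commutator with Y: the terms in D^3 recombine into the
    operator itself, so that on an eigenvector only the term in c' D^2 is not
    a multiple of p or a derivative. *)
Lemma deriv_third_order_comm c p :
  (third_order c (Y * p) - Y * third_order c p + 2 * (Y * p))^`()
  = 3 * (third_order c p + p + c^`() * p^`(2)).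
Proof.
by rewrite third_order_comm /third_order !derE; ring.
Qed.

(** When c has a double root - s, the operator is N = y D - V for y = Y + s, and
    V lowers the degree in y by exactly one; so [y D, V] = - V, and hence
    [N, V] = - V. *)
Lemma third_order_lowering s b p :
  let V q := s%:P * q^`() + b%:P * (Y + s%:P) ^+ 2 * q^`(3) in
  let N := third_order (- (b%:P * (Y + s%:P) ^+ 2)) in
  N (V p) = V (N p) - V p.
Proof.
move=> V N.
have NE q : N q = (Y + s%:P) * q^`() - V q by rewrite /N /V /third_order; ring.
have VB q r : V (q - r) = V q - V r by rewrite /V derivB derivnB; ring.
have euler : (Y + s%:P) * (V p)^`() = V ((Y + s%:P) * p^`()) - V p.
  by rewrite /V !expr2 !derE; ring.
by rewrite !NE euler VB; ring.
Qed.

Lemma third_order_cubic c (b a g : K) :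
  third_order c (Y ^+ 3 - b%:P * Y ^+ 2 - a%:P * Y - g%:P)
  = 3 * Y ^+ 3 - 2 * b%:P * Y ^+ 2 - a%:P * Y + 6 * c.
Proof.
by rewrite /third_order !(exprS, expr0) !mulr1 !derE; ring.
Qed.

End Operators.

Arguments third_order : simpl never.

(** * Rigidity of 2-orthogonal eigensequences *)

Section EigenSequence.
Variables (K : numFieldType) (P : nat -> {poly K}).
Variables (u : nat -> {scalar {poly K}}) (beta alpha gamma : nat -> K).
Variables (c : {poly K}) (tau : K).

Local Notation Y := ('X - (beta 0%N)%:P).
Local Notation b n := (beta n - beta 0%N).
Local Notation N := (third_order Y c).
Local Notation lambda n := (n%:R + tau * 'C(n, 3)%:R).

Hypothesis mpsP : monic_poly_seq P.
Hypothesis dualPu : dual_seq P u.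
Hypothesis recP : recurrence_coefficients P beta alpha gamma.
Hypothesis eigP : forall n, N (P n) = lambda n *: P n.

Let derivY : Y^`() = 1.
Proof. by rewrite derivB derivX derivC subr0. Qed.

Let gamma_neq0 n : gamma n.+1 != 0.
Proof. by case: recP. Qed.

Lemma mulY_P0 : Y * P 0 = P 1.
Proof. by case: recP => -> -> *; rewrite mulr1. Qed.

Lemma mulY_P1 : Y * P 1 = P 2 + b 1 *: P 1 + alpha 1 *: P 0.
Proof.
by case: recP => P0 _ -> *; rewrite P0 -!mul_polyC polyCB; ring.
Qed.

Lemma mulY_PSS n : Y * P n.+2 = P n.+3 + b n.+2 *: P n.+2
  + alpha n.+2 *: P n.+1 + gamma n.+1 *: P n.
Proof.
by case: recP => _ _ _ /(_ n) -> _; rewrite -!mul_polyC polyCB; ring.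
Qed.

(** The next three lemmas are the transposes of the eigenvalue equation and of
    the recurrence relation. As they hold for every polynomial p, they compute
    any matrix entry in the basis P of a word in N and Y by rewriting. *)
Lemma dual_eigen i p : u i (N p) = lambda i * u i p.
Proof.
move: p; apply: (mps_ind mpsP) => [|a p q up uq|n].
- by rewrite !linear0 mulr0.
- by rewrite !linearP /= up uq; ring.
rewrite eigP scalarZ dualPu.
by case: eqVneq => [->|_]; rewrite ?mulr0.
Qed.

Lemma dual_mulY0 p : u 0 (Y * p) = alpha 1 * u 1 p + gamma 1 * u 2 p.
Proof.
move: p; apply: (mps_ind mpsP) => [|a p q up uq|[|[|n]]].
- by rewrite mulr0 !linear0 !mulr0 addr0.
- by rewrite mulrDr -scalerAr !linearP /= up uq; ring.
- by rewrite mulY_P0 !dualPu /=; ring.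
- by rewrite mulY_P1 !linearD !scalarZ !dualPu /=; ring.
rewrite mulY_PSS !linearD !scalarZ !dualPu !eqSS.
by case: n => [|[|n]] /=; ring.
Qed.

Lemma dual_mulYS i p : u i.+1 (Y * p) = u i p + b i.+1 * u i.+1 p
  + alpha i.+2 * u i.+2 p + gamma i.+2 * u i.+3 p.
Proof.
have delta (F : nat -> K) j k : F k * (j == k)%:R = F j * (j == k)%:R.
  by case: eqVneq => [->|]; rewrite ?mulr0.
move: p; apply: (mps_ind mpsP) => [|a p q up uq|[|[|n]]].
- by rewrite mulr0 !linear0 !mulr0 !addr0.
- by rewrite mulrDr -scalerAr !linearP /= up uq; ring.
- by rewrite mulY_P0 !dualPu !eqSS /=; ring.
- rewrite mulY_P1 !linearD !scalarZ !dualPu !eqSS.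
  by case: i => [|i] /=; ring.
rewrite mulY_PSS !linearD !scalarZ !dualPu !eqSS.
rewrite (delta (fun k => b k.+1) i n.+1) (delta (fun k => alpha k.+2) i n).
by rewrite (delta (fun k => gamma k.+1) i.+1 n).
Qed.

Lemma dual_comm i n : (lambda i - lambda n) * u i (Y * P n)
  = u i (Y * P n) + u i (3 * c * (P n)^`(2)).
Proof.
rewrite -linearD -(third_order_comm derivY) linearB dual_eigen eigP.
by rewrite -scalerAr scalarZ mulrBl.
Qed.

(** On P 1 the term in D^2 of [N, Y] vanishes, so the entries of Y in column 1
    are eigenvalue differences times themselves. *)
Lemma beta1_alpha1 : beta 1%N = beta 0%N /\ alpha 1%N = 0.
Proof.
have mulYP1 i : (lambda i - lambda 1) * u i (Y * P 1) = u i (Y * P 1).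
  rewrite dual_comm; have -> : (P 1)^`(2) = 0.
    by apply: derivn_poly0; rewrite (mpsP 1).2.
  by rewrite mulr0 linear0 addr0.
have := mulYP1 0%N; have := mulYP1 1%N.
rewrite mulY_P1 !linearD !scalarZ !dualPu !bin_small //=.
rewrite !(mulr0, mulr1, addr0, add0r, mul0r) subrr mul0r mulN1r.
move=> /esym/subr0_eq beta1 alpha1N; split=> //.
have : 2 * alpha 1%N = 0 by rewrite mulr_natl mulr2n -{1}alpha1N addNr.
by move/eqP; rewrite mulf_eq0 pnatr_eq0 => /eqP.
Qed.

Let beta1 : beta 1%N = beta 0%N := beta1_alpha1.1.
Let alpha1 : alpha 1%N = 0 := beta1_alpha1.2.

Lemma P1_E : P 1 = Y.
Proof. by case: recP => _ -> *. Qed.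

Lemma P2_E : P 2 = Y ^+ 2.
Proof.
by rewrite expr2 -{2}P1_E mulY_P1 alpha1 beta1 subrr !scale0r !addr0.
Qed.

Lemma P3_E : P 3 = Y ^+ 3 - (b 2)%:P * Y ^+ 2 - (alpha 2)%:P * Y - (gamma 1)%:P.
Proof.
have [P0 _ _ _ _] := recP; have := mulY_PSS 0.
rewrite P2_E P1_E P0 -!mul_polyC => YP2.
by rewrite [Y ^+ 3]exprS YP2; ring.
Qed.

(** Since P 3 is a cubic, c occurs only as 6 c in the eigenvalue equation for
    n = 3, which therefore determines it. *)
Lemma operator_coefficient_E : 6 * c =
  tau%:P * Y ^+ 3 - ((1 + tau) * b 2)%:P * Y ^+ 2
  - ((2 + tau) * alpha 2)%:P * Y - ((3 + tau) * gamma 1)%:P.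
Proof.
have := eigP 3; rewrite P3_E (third_order_cubic derivY) binn -mul_polyC.
move/eqP; rewrite -subr_eq0 => /eqP eig3.
by apply: subr0_eq; rewrite -[RHS]eig3; ring.
Qed.

Let dualE := (dual_eigen, linearB, linearD, linearN, dual_mulY0, dual_mulYS).

(** The entry (i, n), in the basis P, of the identity
    [[[N, Y], Y], Y] = 6 c. *)
Lemma dual_triple_comm i n :
  lambda i * u i (Y * (Y * (Y * P n))) - 3 * u i (Y * N (Y * (Y * P n)))
  + 3 * u i (Y * (Y * N (Y * P n))) - lambda n * u i (Y * (Y * (Y * P n)))
  = tau * u i (Y * (Y * (Y * P n))) - (1 + tau) * b 2 * u i (Y * (Y * P n))
   - (2 + tau) * alpha 2 * u i (Y * P n) - (3 + tau) * gamma 1 * u i (P n).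
Proof.
have u3 p : u i (3 * p) = 3 * u i p by rewrite -polyC_natr mul_polyC scalarZ.
transitivity (u i (6 * c * P n)).
  rewrite -(third_order_triple_comm derivY) linearB linearD linearB !u3 eigP.
  by rewrite -!scalerAr scalarZ dual_eigen.
rewrite operator_coefficient_E; move: ('X - _) => y.
rewrite !exprS expr0 mulr1 !mulrBl !linearB -!mulrA.
by rewrite !mul_polyC !scalarZ !mulrA.
Qed.

(** The entry (0, 6). The only way from P 6 down to P 0 in three factors Y is
    6, 4, 2, 0, so both sides are multiples of gamma_1 gamma_3 gamma_5: the
    left one by lambda 0 - 3 lambda 2 + 3 lambda 4 - lambda 6 = - 8 tau, the
    right one by tau. *)
Lemma cubic_eigenvalue0 : tau = 0.
Proof.
have G0 : gamma 1%N * gamma 3%N * gamma 5%N != 0 by rewrite !mulf_neq0.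
apply: (mulIf G0); rewrite mul0r.
have C63 : 'C(6, 3) = 20%N by [].
have C43 : 'C(4, 3) = 4%N by [].
have := dual_triple_comm 0 6.
rewrite !dualE !dualPu /= C63 C43 alpha1 binn !(@bin_small _ 3) //.
rewrite !(mulr0, mulr1, addr0, add0r, mul0r, subr0, sub0r) => E.
by apply: (@eq_of_scaled_sub _ 8 _ _ _ _ (esym E)); ring.
Qed.

Let tau0 := cubic_eigenvalue0.

(** Column 1 of the triple commutator determines beta_3, alpha_3 and gamma_2.
    After their elimination, the entry (1, 2) says that the discriminant of the
    quadratic 6 c is 0. *)
Lemma low_recurrence_coefficients :
  alpha 3 = b 2 ^+ 2 + 3 * alpha 2 /\ alpha 2 ^+ 2 = 3 * b 2 * gamma 1.
Proof.
have b1 : b 1 = 0 by rewrite beta1 subrr.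
pose ring0E := (mulr0, mulr1, addr0, add0r, mul0r, subr0).
have YP1 : Y * P 1 = P 2 by rewrite mulY_P1 alpha1 b1 !scale0r !addr0.
have b3 : b 3 = 3 * b 2.
  have := dual_triple_comm 3 1.
  rewrite YP1 eigP -!scalerAr !scalarZ !dualE !dualPu /= tau0 ?b1 !ring0E => E.
  by apply: (@eq_of_scaled_sub _ 0 _ _ _ _ (esym E)); ring.
have a3 : alpha 3 = b 2 ^+ 2 + 3 * alpha 2.
  have := dual_triple_comm 2 1.
  rewrite YP1 eigP -!scalerAr !scalarZ !dualE !dualPu /= tau0 ?b1 !ring0E => E.
  by apply: (@eq_of_scaled_sub _ 1 _ _ _ _ (esym E)); ring.
have g2 : gamma 2 = 3 * gamma 1 + b 2 * alpha 2 / 3.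
  have := dual_triple_comm 1 1.
  rewrite YP1 eigP -!scalerAr !scalarZ !dualE !dualPu /= tau0 ?b1 !ring0E => E.
  by apply: (@eq_of_scaled_sub _ 2 _ _ _ _ (esym E)); field.
(* The column Y * P 2, expanded beforehand to keep the rewriting below small. *)
have uYP2 k : u k (Y * P 2) = (k == 3%N)%:R + b 2 * (k == 2%N)%:R
    + alpha 2 * (k == 1%N)%:R + gamma 1 * (k == 0%N)%:R.
  by rewrite mulY_PSS !linearD !scalarZ !dualPu.
have := dual_triple_comm 1 2; move: uYP2; move: (Y * P 2) => YP2 uYP2.
rewrite !dualE !uYP2 !dualPu /= tau0 ?b1 !ring0E ?b3 ?a3 ?g2 ?alpha1 => E.
by split=> //; apply: (@eq_of_scaled_sub _ 3 _ _ _ _ E); field.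
Qed.

(** * The derivative sequence *)

Let b2 := b 2.
(** Minus half of the derivative of 6 c. *)
Let ell : {poly K} := b2%:P * Y + (alpha 2)%:P.

Let c_E : 6 * c = - (b2%:P * Y ^+ 2 + (2 * alpha 2)%:P * Y + (3 * gamma 1)%:P).
Proof. by rewrite operator_coefficient_E tau0 /b2; ring. Qed.

Let dual_N i p : u i (N p) = i%:R * u i p.
Proof. by rewrite dual_eigen tau0 mul0r addr0. Qed.

Let N_P n : N (P n) = n%:R *: P n.
Proof. by rewrite eigP tau0 mul0r addr0. Qed.

(** If b2 != 0 then ell = b2 (Y + s), where - s is the double root of c, and
    (Y + s) P_n' = N P_n + V P_n. Since [N, V] = - V, the polynomial V P_n is an
    eigenvector for n - 1, hence a multiple of P_(n-1). If b2 = 0 then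
    alpha_2 = 0, so ell = 0. *)
Lemma dual_ell_deriv i n : (i.+1 < n)%N -> u i (ell * (P n)^`()) = 0.
Proof.
move=> ltin; have [_ sqr_a2] := low_recurrence_coefficients.
have [b20|b2_neq0] := eqVneq b2 0.
  have a20 : alpha 2 = 0.
    by apply/eqP; rewrite -sqrf_eq0 sqr_a2 -/b2 b20 mulr0 mul0r.
  by rewrite /ell b20 a20 mul0r addr0 mul0r linear0.
pose s := alpha 2 / b2.
have lE : ell = b2%:P * (Y + s%:P).
  by rewrite /ell [RHS]mulrDr -polyCM mulrC [b2 * s]mulrC divfK // mulrC.
have cE : c = - ((b2 / 6)%:P * (Y + s%:P) ^+ 2).
  have g1E : gamma 1%N = alpha 2 ^+ 2 / (3 * b2).
    by rewrite sqr_a2 -/b2; field; rewrite b2_neq0.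
  have poly6 : (6%:R : {poly K}) != 0.
    by rewrite -polyC_natr polyC_eq0 pnatr_eq0.
  apply: (mulfI poly6); rewrite c_E g1E.
  have -> : alpha 2 = b2 * s by rewrite mulrC divfK.
  have -> : 3 * ((b2 * s) ^+ 2 / (3 * b2)) = b2 * s ^+ 2 by field.
  by rewrite [in LHS](_ : b2 = 6 * (b2 / 6)); [ring|field].
have := third_order_lowering derivY s (b2 / 6) (P n).
rewrite -cE; set V := fun q => _; rewrite -/(V (P n)) /= => lowering.
have VZ a q : V (a *: q) = a *: V q.
  by rewrite /V derivZ derivnZ -!mul_polyC; ring.
have uV0 j : (j.+1 == n) = false -> u j (V (P n)) = 0.
  move=> neqjn; have := congr1 (u j) lowering.
  rewrite linearB dual_N N_P VZ scalarZ => E; apply/eqP.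
  have : (j.+1%:R - n%:R) * u j (V (P n)) = 0.
    by rewrite -(subrr (j%:R * u j (V (P n)))) {2}E -natr1; ring.
  by move/eqP; rewrite mulf_eq0 subr_eq0 eqr_nat neqjn.
have -> : ell * (P n)^`() = b2 *: (N (P n) + V (P n)).
  by rewrite -mul_polyC lE /V /third_order cE; ring.
rewrite scalarZ linearD N_P scalarZ dualPu uV0 ?ltn_eqF // 1?ltnW //.
by rewrite mulr0 addr0 mulr0.
Qed.

Local Notation v := (deriv_dual u).
Let v_deriv := deriv_dual_deriv mpsP dualPu.

(** The form v_i applied to [deriv_third_order_comm] at P n; as c' is
    proportional to ell, the term c' P_n'' is (ell P_n')' up to P_n'. *)
Lemma deriv_dual_P i n : 3 * n.+1%:R * v i (P n) = i.+1%:R *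
  ((i.+3%:R - n%:R) * u i.+1 (Y * P n) + u i.+1 (ell * (P n)^`())
   - b2 * u i.+1 (P n)).
Proof.
have dl : ell^`() = b2%:P.
  by rewrite /ell !(derivY, derivD, derivM, derivC); ring.
have c'E : 3 * c^`() = - ell.
  have poly2 : (2%:R : {poly K}) != 0.
    by rewrite -polyC_natr polyC_eq0 pnatr_eq0.
  have d6 : (6%:R : {poly K})^`() = 0 by rewrite -polyC_natr derivC.
  have /(congr1 (@deriv K)) := c_E.
  rewrite derivM d6 expr2 !(derivY, derivN, derivD, derivM, derivC).
  move=> E; apply: (mulfI poly2).
  have -> : 2 * (3 * c^`()) = 0 * c + 6 * c^`() by ring.
  by rewrite E /ell; ring.
have lP'' : ell * (P n)^`(2) = (ell * (P n)^`())^`() - b2 *: (P n)^`().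
  by rewrite derivM dl !derivnS derivn0 -mul_polyC; ring.
have rhs : 3 * (N (P n) + P n + c^`() * (P n)^`(2))
    = (3 * n.+1%:R) *: P n - (ell * (P n)^`())^`() + b2 *: (P n)^`().
  transitivity ((3 * n.+1%:R) *: P n - ell * (P n)^`(2)).
    by rewrite -[ell]opprK -c'E N_P -!mul_polyC -natr1; ring.
  by rewrite lP'' opprB addrA addrAC.
have lhs : N (Y * P n) - Y * N (P n) + 2 * (Y * P n)
    = N (Y * P n) + (2 - n%:R) *: (Y * P n).
  by rewrite N_P -!mul_polyC; ring.
have := congr1 (v i) (deriv_third_order_comm derivY c (P n)).
rewrite lhs rhs v_deriv linearD dual_N !(linearD, linearN) !scalarZ /=.
rewrite !v_deriv => E.
apply: (@eq_of_scaled_sub _ 0 _ _ _ _ (esym E)).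
by rewrite -!natr1; ring.
Qed.

Lemma dual_mulY_band i n : (i + 2 < n)%N -> u i (Y * P n) = 0.
Proof.
case: i => [|i] ltin.
  by rewrite dual_mulY0 !dualPu !ltn_eqF ?mulr0 ?addr0 //; lia.
by rewrite dual_mulYS !dualPu !ltn_eqF ?mulr0 ?addr0 //; lia.
Qed.

Lemma dual_mulY_corner i : u i (Y * P i.+2) = gamma i.+1.
Proof.
case: i => [|i]; first by rewrite dual_mulY0 !dualPu mulr0 add0r mulr1.
by rewrite dual_mulYS !dualPu eqxx !(@ltn_eqF _ i.+3) //=; [ring|lia].
Qed.

(** In [deriv_dual_P] the bandwidth of Y only yields n > i + 3. The case
    n = i + 3 is saved by the factor i + 3 - n. *)
Lemma deriv_dual_P_band i n : (i + 2 < n)%N -> v i (P n) = 0.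
Proof.
move=> ltin; have := deriv_dual_P i n.
have -> : (i.+3%:R - n%:R) * u i.+1 (Y * P n) = 0.
  have [->|neqn] := eqVneq n i.+3; first by rewrite subrr mul0r.
  by rewrite dual_mulY_band ?mulr0 //; lia.
rewrite dual_ell_deriv ?dualPu ?ltn_eqF /=; try lia.
rewrite mulr0 subr0 addr0 mulr0 => /eqP.
by rewrite -natrM mulf_eq0 pnatr_eq0 => /eqP.
Qed.

Lemma deriv_MPS_two_orthogonal : two_orthogonal_MPS (deriv_MPS P).
Proof.
have mpsQ := deriv_MPS_monic mpsP; split=> //; exists v.
have dualQv := deriv_dual_dual mpsP dualPu; split=> //.
have vXQ i n : v i ('X * deriv_MPS P n) = n.+1%:R^-1
    * (i.+1%:R * (u i.+1 (Y * P n.+1) + beta 0%N * u i.+1 (P n.+1))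
       - v i (P n.+1)).
  have XdP : 'X * (P n.+1)^`()
      = (Y * P n.+1)^`() - P n.+1 + beta 0%N *: (P n.+1)^`().
    by rewrite derivM derivY -mul_polyC; ring.
  rewrite -scalerAr scalarZ XdP !linearD linearN scalarZ /= !v_deriv.
  by ring.
apply: two_orthogonal_of_band => // [i n ltin|i]; rewrite /= vXQ dualPu.
  rewrite dual_mulY_band ?deriv_dual_P_band ?ltn_eqF; try lia.
  by rewrite mulr0 addr0 mulr0 subr0 mulr0.
rewrite deriv_dual_P_band ?dual_mulY_corner ?ltn_eqF; try lia.
by rewrite mulr0 addr0 subr0 !mulf_neq0 ?invr_eq0 ?pnatr_eq0.
Qed.

(** Each P n below is, up to known terms, a derivative: P 0, P 1 and P 2 are
    multiples of (P 1)', (P 2)' and (Y P_2)'; and P 3 is Y P_2 up to a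
    combination of them, with Y P_2 = Y^3 a multiple of (Y^2 P_2)'. *)
Lemma deriv_dual_low_values :
  [/\ forall i, v i (P 0) = (i == 0%N)%:R, forall i, v i (P 1) = (i == 1%N)%:R,
      v 0 (P 2) = alpha 2 / 3, v 1 (P 2) = 2 * b2 / 3
    & v 1 (P 3) = alpha 3 / 3].
Proof.
have [a3E _] := low_recurrence_coefficients.
have vE i q p k : q^`() = k.+1%:R *: p -> v i p = i.+1%:R / k.+1%:R * u i.+1 q.
  move=> dq; rewrite mulrAC -v_deriv dq scalarZ /= mulrAC divff ?mul1r //.
  by rewrite pnatr_eq0.
have v0 i : v i (P 0) = (i == 0%N)%:R.
  rewrite (@vE i (P 1) _ 0) ?P1_E ?derivY.
    by rewrite -P1_E dualPu eqSS divr1; case: i => [|i] /=; ring.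
  by case: recP => ->; rewrite scale1r.
have v1 i : v i (P 1) = (i == 1%N)%:R.
  rewrite (@vE i (P 2) _ 1).
    rewrite dualPu eqSS; case: i => [|[|i]] /=; rewrite ?mulr0 //.
    by rewrite divff ?mulr1 ?pnatr_eq0.
  by rewrite P2_E P1_E expr2 derivM derivY -mul_polyC; ring.
have v2 i : v i (P 2) = i.+1%:R / 3 * u i.+1 (Y * P 2).
  apply: vE; rewrite P2_E expr2; move: Y derivY => y dy.
  by rewrite !derivM dy -mul_polyC; ring.
have v3 : v 1 (P 3) = alpha 3 / 3.
  have -> : P 3 = Y * P 2 - b2 *: P 2 - alpha 2 *: P 1 - gamma 1 *: P 0.
    by rewrite mulY_PSS -!mul_polyC /b2; ring.
  rewrite !linearB !scalarZ /= v2 v1 v0 /= (@vE _ (Y * (Y * P 2)) _ 3%N).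
    rewrite !dual_mulYS !dualPu /= a3E /b2 beta1 subrr; by field.
  rewrite P2_E expr2; move: Y derivY => y dy.
  by rewrite !derivM dy -mul_polyC; ring.
split=> //; rewrite v2 dual_mulYS !dualPu /= ?beta1 /b2; by field.
Qed.

Lemma deriv_dual0 q : v 0 q = u 0 q + alpha 2 / 3 * u 2 q.
Proof.
have [v0 v1 v02 _ _] := deriv_dual_low_values.
move: q; apply: (mps_ind mpsP) => [|a p q vp vq|[|[|[|n]]]].
- by rewrite !linear0; ring.
- by rewrite !linearP /= vp vq; ring.
- by rewrite v0 !dualPu /=; ring.
- by rewrite v1 !dualPu /=; ring.
- by rewrite v02 !dualPu /=; ring.
by rewrite deriv_dual_P_band // !dualPu /=; ring.
Qed.

Lemma deriv_dual1 q :
  v 1 q = u 1 q + 2 * b2 / 3 * u 2 q + alpha 3 / 3 * u 3 q.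
Proof.
have [v0 v1 _ v12 v13] := deriv_dual_low_values.
move: q; apply: (mps_ind mpsP) => [|a p q vp vq|[|[|[|[|n]]]]].
- by rewrite !linear0; ring.
- by rewrite !linearP /= vp vq; ring.
- by rewrite v0 !dualPu /=; ring.
- by rewrite v1 !dualPu /=; ring.
- by rewrite v12 !dualPu /=; ring.
- by rewrite v13 !dualPu /=; ring.
by rewrite deriv_dual_P_band // !dualPu /=; ring.
Qed.

Lemma functional_equation (i : 'I_2) :
  form_deriv (form_mulmx (Phi beta alpha gamma 0) (form_pair u) i)
  \+ form_mulmx (Psi beta gamma) (form_pair u) i =1 \0.
Proof.
move=> p; set q := p^`().
have g1 := gamma_neq0 0; have g2 := gamma_neq0 1.
have uY0 r : u 0 (Y * r) = gamma 1 * u 2 r.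
  by rewrite dual_mulY0 alpha1 mul0r add0r.
have uY1 : u 1 (Y * q) = u 0 q + alpha 2 * u 2 q + gamma 2 * u 3 q.
  by rewrite dual_mulYS beta1; ring.
have v0q := v_deriv 0 p; have v1q := v_deriv 1 p; rewrite -/q in v0q v1q.
rewrite deriv_dual0 mul1r in v0q; rewrite deriv_dual1 in v1q.
have mulmx2 (M : 'M[{poly K}]_2) j r :
    form_mulmx M (form_pair u) j r = u 0 (M j ord0 * r) + u 1 (M j ord_max * r).
  rewrite /form_mulmx !big_ord_recl big_ord0 addr0; congr (_ + u 1 (M j _ * r)).
  exact/val_inj.
have affE x y r : (x *: 'X + y%:P) * r = x *: (Y * r) + (x * beta 0 + y) *: r.
  by rewrite -!mul_polyC; ring.
have uaff k x y r : u k ((x *: 'X + y%:P) * r)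
    = x * u k (Y * r) + (x * beta 0 + y) * u k r.
  by rewrite affE linearD !scalarZ.
(* The entry phi21 is affine here. Only its slope x and its value at beta_0
   matter, since phi21 u_0 = x Y u_0 + phi21(beta_0) u_0. *)
have phi21E : exists x y, phi21 beta alpha gamma 0 = x *: 'X + y%:P
    /\ x * gamma 1 + alpha 2 * alpha 3 / (3 * gamma 2) = 2 * b2 / 3
    /\ x * beta 0 + y = - alpha 3 / (3 * gamma 2).
  rewrite /phi21 mulr0 scale0r add0r; do 2!eexists; split; first reflexivity.
  by split; rewrite /b2; field; apply/andP.
have [x21 [y21 [phi21E' [x21E y21E]]]] := phi21E.
rewrite /= /form_deriv /= -/q !mulmx2 !mxE /=.
have [->|->] : i = ord0 \/ i = ord_max.
  by case: i => -[|[|]] //= ?; [left|right]; apply/val_inj.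
  rewrite /= /phi11 /phi12 !uaff (mul0r p) linear0 (mul1r p) -v0q uY0 beta1.
  by field.
rewrite /= phi21E' /phi22 !uaff (mul0r p) linear0 addr0 y21E uY0 uY1.
rewrite /E1 -scalerAl -scalerAl !scalarZ uY0 mulKf // -v1q beta1.
have -> : x21 = (2 * b2 / 3 - alpha 2 * alpha 3 / (3 * gamma 2)) / gamma 1.
  by rewrite -x21E; field; apply/andP.
by field; apply/andP.
Qed.

End EigenSequence.

(** * The operator J *)

Lemma eigenvalJ_E (K : numFieldType) (a0 a1 a2 a3 : {poly K}) n :
  eigenvalJ a0 a1 a2 a3 n = a0`_0 + n%:R * a1`_1 + 'C(n, 2)%:R * a2`_2
                            + 'C(n, 3)%:R * a3`_3.
Proof.
pose F mu := 'C(n, mu)%:R * ([:: a0; a1; a2; a3]`_mu)`_mu.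
have F0 m k : (forall i : 'I_k, F (m + i)%N = 0) ->
    \sum_(mu < m + k) F mu = \sum_(mu < m) F mu.
  by move=> Fmk; rewrite big_split_ord /= [X in _ + X]big1 ?addr0.
(* The range mu < n.+1 is extended to mu < n + 4, then cut down to mu < 4: the
   binomial vanishes beyond n, and the list of coefficients beyond 3. *)
rewrite /eigenvalJ -/F -[LHS](F0 _ 3) => [|i]; last first.
  by rewrite /F bin_small ?mul0r // addSn ltnS leq_addr.
rewrite [LHS](_ : _ = \sum_(mu < 4 + n) F mu); last by rewrite addnC addSnnS.
rewrite F0 => [|i]; last by rewrite /F /= nth_nil coef0 mulr0.
by rewrite !big_ord_recl big_ord0 /F /= bin0 bin1 mul1r addr0 !addrA.
Qed.

(** The factor - 3 g = - 3 gamma_1 is the one that makes the coefficient of D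
    equal to Y; the constant a_0 is absorbed in the eigenvalue. *)
Lemma opJ_normal_form (K : numFieldType) (a0 a3 p : {poly K}) (b g : K) n :
  (size a0 <= 1)%N -> g != 0 ->
  let a1 := - (1 / (3 * g)) *: ('X - b%:P) in
  opJ a0 a1 0 a3 p = eigenvalJ a0 a1 0 a3 n *: p ->
  third_order ('X - b%:P) (- (g / 2) *: a3) p
    = (n%:R + - (3 * g * a3`_3) * 'C(n, 3)%:R) *: p.
Proof.
move=> sz0 g_neq0 a1; rewrite eigenvalJ_E /opJ /third_order.
rewrite [X in X * p](size1_polyC sz0).
have -> : a1`_1 = - (1 / (3 * g)).
  by rewrite /a1 coefZ coefB coefX coefC subr0 mulr1.
rewrite coef0 mulr0 addr0 scaler0 mul0r addr0 /a1.
set Y := 'X - b%:P => eigp.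
have scaled : - (3 * g) *: ((a0`_0)%:P * p + - (1 / (3 * g)) *: Y * p^`()
      + 3`!%:R^-1 *: a3 * p^`(3) - a0`_0 *: p)
    = (- (3 * g) * - (1 / (3 * g))) *: (Y * p^`())
      + (- (3 * g) * 3`!%:R^-1) *: a3 * p^`(3).
  by rewrite -!mul_polyC; ring.
have -> : - (g / 2) = - (3 * g) * 3`!%:R^-1.
  by rewrite (_ : 3`! = 6%N) //; field.
have one : - (3 * g) * - (1 / (3 * g)) = 1 by field.
move: scaled; rewrite one scale1r => <-; rewrite eigp -scalerBl scalerA.
by congr (_ *: p); field.
Qed.

Theorem theorem4p2 (R : realType)
  (a0 a1 a2 a3 : {poly R[i]})
  (sz0 : (size a0 <= 1)%N) (sz1 : (size a1 <= 2)%N)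
  (sz2 : (size a2 <= 3)%N) (sz3 : (size a3 <= 4)%N)
  (J_iso : forall n, eigenvalJ a0 a1 a2 a3 n != 0)
  (P : nat -> {poly R[i]}) (u : nat -> {scalar {poly R[i]}})
  (beta alpha gamma : nat -> R[i])
  (P_mps : monic_poly_seq P)
  (u_dual : dual_seq P u)
  (P_2orth : two_orthogonal_wrt P (form_pair u))
  (P_rec : recurrence_coefficients P beta alpha gamma)
  (P_eigen : forall n,
    opJ a0 a1 a2 a3 (P n) = eigenvalJ a0 a1 a2 a3 n *: P n)
  (a2_eq : a2 = 0)
  (a1_eq : a1 = - (1 / (3 * gamma 1%N)) *: ('X - (beta 0%N)%:P))
  (a33_neq : forall m : nat, a3`_3 != 1 / (gamma 1%N * m.+1%:R)) :
  Hahn_classical P /\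
  (forall i : 'I_2,
     form_deriv (form_mulmx (Phi beta alpha gamma a3`_3) (form_pair u) i)
     \+ form_mulmx (Psi beta gamma) (form_pair u) i =1 \0).
Proof.
have [_ _ _ _ gamma_neq0] := P_rec.
have eigP n : third_order ('X - (beta 0%N)%:P) (- (gamma 1%N / 2) *: a3) (P n)
    = (n%:R + - (3 * gamma 1%N * a3`_3) * 'C(n, 3)%:R) *: P n.
  apply: (opJ_normal_form sz0 (gamma_neq0 0%N)).
  by rewrite -a1_eq -a2_eq P_eigen.
have a33_0 : a3`_3 = 0.
  have /eqP := cubic_eigenvalue0 P_mps u_dual P_rec eigP.
  rewrite oppr_eq0 !mulf_eq0 pnatr_eq0 /= (negPf (gamma_neq0 0%N)) /=.
  by move/eqP.
split.
  split; first by split=> //; exists u.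
  exact: deriv_MPS_two_orthogonal P_mps u_dual P_rec eigP.
move=> i; rewrite a33_0.
exact: functional_equation P_mps u_dual P_rec eigP i.
Qed.
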